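(* Let $1\le k\le N-1$ satisfy $\phi^{k-1}-\phi^k>\phi^k-\phi^{k+1}$, let $F\in\tilde{\mathcal F}^k$, let $\mathcal U$ be an unlabeled atom and $\mathcal M$ a labeled atom of $\mathfrak A_k$. If $F$ contains an arc leaving $\mathcal U$ whose head lies in $\mathcal M$, then this arc is the only arc of $F$ leaving $\mathcal U$.
   Context: $V$ is a digraph with vertex set $\mathcal N$, $|\mathcal N|=N$, real arc weights, having at least one spanning tree. An (entering) forest is a digraph in which every vertex has at most one outgoing arc and there is no directed cycle; its weakly connected components are trees, each with a root (the unique vertex with no outgoing arc). $\mathcal F^k$ is the set of spanning forests of $V$ with exactly $k$ trees; $\Upsilon^F$ is total arc weight; $\phi^k=\min_{\mathcal F^k}\Upsilon^F$, $\phi^0=\infty$; $\tilde{\mathcal F}^k$ the forests in $\mathcal F^k$ of weight $\phi^k$. $\mathfrak A_k$ is the algebra of subsets of $\mathcal N$ generated by the vertex sets of trees of forests in $\tilde{\mathcal F}^k$; atoms are its minimal nonempty elements; an atom is labeled if it contains a root of some forest of $\tilde{\mathcal F}^k$, unlabeled otherwise. An arc leaves $\mathcal U$ if its tail is in $\mathcal U$ and its head is not. *)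

(* Defs.v *)
From HB Require Import structures.
From mathcomp Require Import all_boot all_order all_algebra.
From mathcomp Require Import constructive_ereal.
Set Implicit Arguments. Unset Strict Implicit. Unset Printing Implicit Defensive.
Import Order.TTheory GRing.Theory Num.Theory.

(* The digraph V: vertex set T (a finType, N = #|T|), arc set E : {set T * T}
   (an arc (x,y) has tail x and head y), real weights w : T * T -> R. *)

Section Forests.
Variables (T : finType).

Definition is_forest (E F : {set T * T}) : bool :=
  [&& F \subset E,
      [forall x, forall y, forall z, ((x, y) \in F) && ((x, z) \in F) ==> (y == z)] &
      [forall x, forall y, ((x, y) \in F) ==> ~~ connect (fun a b => (a, b) \in F) y x]].

Definition wadj (F : {set T * T}) : rel T :=
  fun a b => ((a, b) \in F) || ((b, a) \in F).

Definition comp (F : {set T * T}) (x : T) : {set T} :=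
  [set y | connect (wadj F) x y].

Definition trees (F : {set T * T}) : {set {set T}} := [set comp F x | x : T].

Definition ntrees (F : {set T * T}) : nat := #|trees F|.

Definition is_root (F : {set T * T}) (x : T) : bool := [forall y, (x, y) \notin F].

Definition leaves (U : {set T}) (e : T * T) : bool := (e.1 \in U) && (e.2 \notin U).

Definition alg_closed (A : {set {set T}}) : bool :=
  (set0 \in A) && [forall X in A, (~: X) \in A] &&
  [forall X in A, forall Y in A, (X :|: Y) \in A].

Definition gen_alg (G : {set {set T}}) : {set {set T}} :=
  \bigcap_(A | alg_closed A && (G \subset A)) A.

Definition is_atom (G : {set {set T}}) (U : {set T}) : bool :=
  (U \in gen_alg G) && (U != set0) &&
  [forall V in gen_alg G, (V \subset U) ==> (V == set0) || (V == U)].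

End Forests.

Section Weights.
Variables (R : realDomainType) (T : finType) (E : {set T * T}) (w : T * T -> R).
Local Open Scope ring_scope.
Local Open Scope ereal_scope.

Definition weight (F : {set T * T}) : R := (\sum_(e in F) w e)%R.

(* phi^k = min weight over spanning forests with exactly k trees;
   it is +oo when there is no such forest (in particular phi^0 = +oo). *)
Definition phi (k : nat) : \bar R :=
  \big[Order.min/+oo]_(F : {set T * T} | is_forest E F && (ntrees F == k))
     (weight F)%:E.

Definition opt_forest (k : nat) (F : {set T * T}) : bool :=
  [&& is_forest E F, ntrees F == k & (weight F)%:E == phi k].

Definition gens (k : nat) : {set {set T}} :=
  [set S | [exists F, opt_forest k F && (S \in trees F)]].

Definition labeled (k : nat) (U : {set T}) : bool :=
  [exists F, exists x, [&& opt_forest k F, is_root F x & x \in U]].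

End Weights.

(* Main.v *)
(** Write [root_of F x] for the root of the tree of [x] in [F], and [swap A B S]
for [A] with the arcs issuing from [S] replaced by those of [B]. If [A] and [B]
are minimal, both [swap A B S] and [swap B A S] are acyclic, and the numbers of
roots of [A] and [B] in [S] differ by at most one, then the strict gap forces
these numbers to be equal and both swaps to be minimal. With [S] a tree of [A]
this gives that every tree of [A] contains exactly one root of [B], and hence
that a labeled atom contains the root of each of its vertices in every minimal
forest.

Suppose [F] has two arcs [(u, m)], [(u', v)] leaving [U] with [m] in [M]. Choose
a minimal [G] separating [v] from [U], let [D] be the tree of [G] containing [U]
and [B := swap G F D]. If [m] is in [D], then [u] has its root in [D] in the
forest [B] but [u'] has not, a contradiction. Otherwise [u] and [u'] both exit
[D] in [B]. Swapping suitable subsets of the [B]-subtrees of [u] and [u'] shows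
that the [G]-path of each of them must meet the [B]-subtree of the other, each
time earlier than the previous time; this descent is impossible. *)

Require Import Defs.
From HB Require Import structures.
From mathcomp Require Import all_boot all_order all_algebra.
From mathcomp Require Import constructive_ereal.
From mathcomp Require Import zify lra.
Import Order.TTheory GRing.Theory Num.Theory.
Local Open Scope ring_scope.

Set Implicit Arguments.
Unset Strict Implicit.
Unset Printing Implicit Defensive.

(** * Reachability and acyclicity in functional digraphs *)

Section Digraphs.
Variable T : finType.
Implicit Types (A B C E F : {set T * T}) (S X D : {set T}) (x y z r : T).

Definition reach F := connect (fun a b => (a, b) \in F).

Definition functional F :=
  forall x y z, (x, y) \in F -> (x, z) \in F -> y = z.

Definition acyclic F := forall x y, (x, y) \in F -> ~~ reach F y x.

Lemma is_forestP E F :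
  reflect [/\ F \subset E, functional F & acyclic F] (is_forest E F).
Proof.
apply: (iffP and3P) => -[sFE ffun acy]; split => //.
- by move=> x y z xy xz; move/forallP/(_ x)/forallP/(_ y)/forallP/(_ z): ffun;
    rewrite xy xz => /eqP.
- by move=> x y xy; move/forallP/(_ x)/forallP/(_ y): acy; rewrite xy.
- apply/forallP => x; apply/forallP => y; apply/forallP => z.
  by apply/implyP => /andP[xy xz]; rewrite (ffun _ _ _ xy xz).
- by apply/forallP => x; apply/forallP => y; apply/implyP => /acy.
Qed.

Lemma reach_closed F (X : {pred T}) :
  (forall x y, (x, y) \in F -> x \in X -> y \in X) ->
  forall x y, reach F x y -> x \in X -> y \in X.
Proof.
move=> clX x y /connectP[p]; elim: p x => [|z p IHp] x /=; first by move=> _ ->.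
by move=> /andP[xz pz] ey xX; apply: IHp pz ey _; apply: clX xz xX.
Qed.

Lemma reach_step F x y :
  reach F x y -> x = y \/ exists2 z, (x, z) \in F & reach F z y.
Proof.
move=> /connectP[[|z p] /=]; first by move=> _ ->; left.
by move=> /andP[xz pz] ->; right; exists z => //; apply/connectP; exists p.
Qed.

Lemma reach_arc F x y z : (x, y) \in F -> reach F y z -> reach F x z.
Proof. by move=> xy; apply: connect_trans; apply: connect1. Qed.

Lemma reach_comparable F x y z :
  functional F -> reach F x y -> reach F x z -> reach F y z \/ reach F z y.
Proof.
move=> ffun /connectP[p]; elim: p x => [|x1 p IHp] x /=.
  by move=> _ ->; left.
move=> /andP[xx1 px1] ey /reach_step[<-|[x2 xx2 x2z]].
  by right; apply: reach_arc xx1 _; apply/connectP; exists p.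
by apply: IHp px1 ey _; rewrite (ffun _ _ _ xx1 xx2).
Qed.

Lemma reach_root F r x : is_root F r -> reach F r x -> x = r.
Proof. by move=> /forallP rF /reach_step[-> //|[z]]; rewrite (negPf (rF z)). Qed.

Lemma acyclic_anti F x y : acyclic F -> reach F x y -> reach F y x -> x = y.
Proof.
move=> acF /reach_step[//|[z xz zy] yx].
by have /negP[] := acF _ _ xz; apply: connect_trans zy yx.
Qed.

(** A cycle of [C] cannot leave the closed set [X], so it lies wholly inside [X], where its arcs
    belong to [A], or wholly outside, where they belong to [B]. *)
Lemma acyclic_split X A B C :
  (forall x y, (x, y) \in C -> x \in X -> y \in X) ->
  (forall x y, (x, y) \in C -> x \in X -> y \in X -> (x, y) \in A) ->
  (forall x y, (x, y) \in C -> x \notin X -> y \notin X -> (x, y) \in B) ->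
  acyclic A -> acyclic B -> acyclic C.
Proof.
move=> clX inA inB acA acB x y xy; apply/negP => yx.
have [xX|xX] := boolP (x \in X).
  have yX := clX _ _ xy xX; have /negP[] := acA _ _ (inA _ _ xy xX yX).
  move: yx yX => /connectP[p]; elim: p y {xy} => [|z p IHp] y /=.
    by move=> _ -> _; apply: connect0.
  move=> /andP[yz pz] ex yX; have zX := clX _ _ yz yX.
  by apply: reach_arc (inA _ _ yz yX zX) _; apply: IHp.
have outX z : reach C z x -> z \notin X.
  by move=> zx; apply: contra xX; apply: (reach_closed clX).
have /negP[] := acB _ _ (inB _ _ xy xX (outX _ yx)).
move: yx => /connectP[p]; elim: p y {xy} => [|z p IHp] y /=.
  by move=> _ ->; apply: connect0.
move=> /andP[yz pz] ex; have zx : reach C z x by apply/connectP; exists p.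
by apply: reach_arc (inB _ _ yz (outX _ _) (outX _ _)) _ => //;
  [apply: reach_arc yz zx | apply: IHp].
Qed.

(** * Roots and trees of a forest *)

Definition roots F := [set r | is_root F r].

(** The default [x] is never taken when [F] is acyclic. *)
Definition root_of F x := odflt x [pick r | reach F x r && is_root F r].

Lemma acyclic_reach_root F x : acyclic F -> exists2 r, reach F x r & is_root F r.
Proof.
(* Following an arc strictly shrinks the set of reachable vertices, since acyclicity removes the
   tail. *)
move=> acF; have [n] := ubnP #|[set z | reach F x z]|; elim: n x => // n IHn x.
have [xr _|] := boolP (is_root F x); first by exists x => //; apply: connect0.
rewrite negb_forall => /existsP[y]; rewrite negbK => xy le_n.
have [|r yr rr] := IHn y; last by exists r => //; apply: reach_arc xy yr.
rewrite ltnS in le_n; apply: leq_trans le_n.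
apply/proper_card/properP; split.
  by apply/subsetP => z; rewrite !inE; apply: reach_arc.
by exists x; rewrite inE; [apply: connect0 | apply: acF].
Qed.

Section Forest.
Variable F : {set T * T}.
Hypotheses (ffun : functional F) (acF : acyclic F).

Lemma root_ofP x : reach F x (root_of F x) /\ is_root F (root_of F x).
Proof.
rewrite /root_of; case: pickP => [r /andP[] // | no].
by have [r xr rr] := acyclic_reach_root x acF; have := no r; rewrite xr rr.
Qed.

Lemma reach_root_of x : reach F x (root_of F x).
Proof. by case: (root_ofP x). Qed.

Lemma root_of_root x : is_root F (root_of F x).
Proof. by case: (root_ofP x). Qed.

Lemma root_of_uniq x r : reach F x r -> is_root F r -> root_of F x = r.
Proof.
have [xs sr] := root_ofP x => xr rr.
by case: (reach_comparable ffun xs xr) => h;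
  rewrite -?(reach_root sr h) // (reach_root rr h).
Qed.

Lemma root_of_id r : is_root F r -> root_of F r = r.
Proof. by apply: root_of_uniq; apply: connect0. Qed.

Lemma root_of_reach x y : reach F x y -> root_of F x = root_of F y.
Proof.
move=> xy; apply: root_of_uniq (root_of_root y).
exact: connect_trans xy (reach_root_of y).
Qed.

Lemma root_of_arc x y : (x, y) \in F -> root_of F x = root_of F y.
Proof. by move=> xy; apply: root_of_reach; apply: connect1. Qed.

Lemma connect_wadj x y : connect (wadj F) x y = (root_of F x == root_of F y).
Proof.
have symw : connect_sym (wadj F).
  by apply: sym_connect_sym => a b; rewrite /wadj orbC.
have reachw a b : reach F a b -> connect (wadj F) a b.
  by apply: connect_sub => c d cd; apply: connect1; rewrite /wadj cd.
apply/idP/eqP => [/connectP[p]|exy].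
  elim: p x => [|z p IHp] x /=; first by move=> _ ->.
  move=> /andP[xz pz] ey; rewrite -(IHp z) //.
  by case/orP: xz => /root_of_arc.
apply: connect_trans (reachw _ _ (reach_root_of x)) _.
by rewrite exy symw; apply: reachw; apply: reach_root_of.
Qed.

Lemma mem_comp x y : (y \in Defs.comp F x) = (root_of F x == root_of F y).
Proof. by rewrite inE connect_wadj. Qed.

Lemma ntreesE : ntrees F = #|roots F|.
Proof.
have -> : ntrees F = #|Defs.comp F @: roots F|.
  congr #|pred_of_set _|; apply/setP => X; apply/imsetP/imsetP => -[x _ ->].
    exists (root_of F x); first by rewrite inE root_of_root.
    by apply/setP => y; rewrite !mem_comp (root_of_id (root_of_root x)).
  by exists x.
apply: card_in_imset => r s; rewrite !inE => rr rs ers.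
have : s \in Defs.comp F r by rewrite ers mem_comp.
by rewrite mem_comp !root_of_id // => /eqP.
Qed.

End Forest.

(** * Exchanging the arcs that issue from a set of vertices *)

Definition swap A B S := [set e in A | e.1 \notin S] :|: [set e in B | e.1 \in S].

Lemma in_swap A B S x y :
  ((x, y) \in swap A B S) = (if x \in S then (x, y) \in B else (x, y) \in A).
Proof. by rewrite !inE /=; case: (x \in S); rewrite ?andbF ?andbT ?orbF. Qed.

Lemma swap_root A B S x :
  is_root (swap A B S) x = if x \in S then is_root B x else is_root A x.
Proof.
by rewrite /is_root; case: ifP => xS; apply: eq_forallb => y; rewrite in_swap xS.
Qed.

Lemma card_roots_swap A B S :
  #|roots (swap A B S)| = (#|roots A :\: S| + #|roots B :&: S|)%N.
Proof.
rewrite -(cardsID S) addnC; congr (_ + _)%N; congr #|pred_of_set _|;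
  apply/setP => x; rewrite !inE swap_root; case: (x \in S);
  by rewrite ?andbF ?andbT.
Qed.

Lemma swap_functional A B S :
  functional A -> functional B -> functional (swap A B S).
Proof.
by move=> fA fB x y z; rewrite !in_swap; case: ifP => _; [apply: fB | apply: fA].
Qed.

Lemma swap_forest E A B S :
  is_forest E A -> is_forest E B -> acyclic (swap A B S) ->
  is_forest E (swap A B S).
Proof.
move=> /is_forestP[/subsetP sA fA _] /is_forestP[/subsetP sB fB _] ac.
apply/is_forestP; split => //; last exact: swap_functional.
by apply/subsetP => -[x y]; rewrite in_swap; case: ifP => _; [apply: sB|apply: sA].
Qed.

Lemma swap_acyclic_closed A B S :
  (forall x y, (x, y) \in B -> x \in S -> y \in S) ->
  acyclic A -> acyclic B -> acyclic (swap A B S).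
Proof.
move=> clS acA acB; apply: (@acyclic_split S B A) => // x y; rewrite in_swap.
- by case: ifP => // xS /clS->.
- by case: ifP.
- by case: ifP.
Qed.

Lemma swap_reach A B S x y :
  (forall z, reach A x z -> z \notin S) -> reach A x y -> reach (swap A B S) x y.
Proof.
move=> avoid /connectP[p]; elim: p x avoid => [|z p IHp] x avoid /=.
  by move=> _ ->; apply: connect0.
move=> /andP[xz pz] ey; apply: (@reach_arc _ _ z).
  by rewrite in_swap (negPf (avoid x _)) //; apply: connect0.
by apply: IHp pz ey => t zt; apply: avoid; apply: reach_arc xz zt.
Qed.

Lemma swap_setC A B S : swap A B (~: S) = swap B A S.
Proof.
by apply/setP => -[x y]; rewrite !in_swap inE; case: (x \in S).
Qed.

End Digraphs.

(** * Generated algebras of sets and their atoms *)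

Section Algebras.
Variables (T : finType).
Implicit Types (G : {set {set T}}) (U V X : {set T}).

Lemma gen_alg_sub G X : X \in G -> X \in gen_alg G.
Proof. by move=> XG; apply/bigcapP => A /andP[_ /subsetP/(_ _ XG)]. Qed.

Lemma gen_alg_ind G (P : pred {set T}) :
  P set0 -> (forall X, P X -> P (~: X)) ->
  (forall X Y, P X -> P Y -> P (X :|: Y)) ->
  (forall X, X \in G -> P X) -> forall X, X \in gen_alg G -> P X.
Proof.
move=> P0 PC PU PG X /bigcapP/(_ [set Y | P Y]); rewrite inE; apply.
apply/andP; split; last by apply/subsetP => Y /PG; rewrite inE.
rewrite /alg_closed inE P0 /=; apply/andP; split; apply/forallP => Y.
  by apply/implyP; rewrite !inE; apply: PC.
apply/implyP; rewrite inE => PY; apply/forallP => Z.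
by apply/implyP; rewrite !inE; apply: PU.
Qed.

Lemma gen_algI G X Y : X \in gen_alg G -> Y \in gen_alg G -> X :&: Y \in gen_alg G.
Proof.
move=> /bigcapP XG /bigcapP YG; apply/bigcapP => A algA.
have XA := XG _ algA; have YA := YG _ algA; move: algA.
rewrite /alg_closed -!andbA => /and4P[_ /forall_inP cA /forall_inP uA _].
rewrite -(setCK X) -(setCK Y) -setCU; apply/cA.
by have /forall_inP := uA _ (cA _ XA); apply; apply: cA.
Qed.

Lemma atom_sub G U X x : is_atom G U -> X \in G -> x \in U -> x \in X -> U \subset X.
Proof.
move=> /andP[/andP[UG _] /forall_inP minU] /gen_alg_sub XG xU xX.
have /implyP := minU _ (gen_algI UG XG); rewrite subsetIl => /(_ isT).
have [|_ /= /eqP <-] := eqVneq (U :&: X) set0; last exact: subsetIr.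
by move/setP/(_ x); rewrite !inE xU xX.
Qed.

(** The sets that do not separate [x] from [y] form an algebra; if it contained all generators it
    would contain [U]. *)
Lemma atom_separate G U x y : is_atom G U -> x \in U -> y \notin U ->
  exists2 X, X \in G & (x \in X) != (y \in X).
Proof.
move=> /andP[/andP[UG _] _] xU yU; apply/exists_inP; apply: contraNT yU.
rewrite negb_exists_in => /forall_inP sepG.
suff /eqP <- : (x \in U) == (y \in U) by [].
apply: (@gen_alg_ind G (fun X => (x \in X) == (y \in X))) UG => //.
- by rewrite !inE.
- by move=> X /eqP xX; rewrite !inE xX.
- by move=> X Y /eqP xX /eqP xY; rewrite !inE xX xY.
- by move=> X /sepG; rewrite negbK.
Qed.

End Algebras.

(** * Minimal forests and exchanges under the strict gap *)

Section Weighted.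
Variables (R : realDomainType) (T : finType) (E : {set T * T}) (w : T * T -> R).
Implicit Types (A B C F : {set T * T}) (S : {set T}).

Lemma phi_le j C : is_forest E C -> ntrees C = j -> (phi E w j <= (weight w C)%:E)%E.
Proof.
by move=> fC nC; apply: (bigmin_le_cond +oo%E (fun C => (weight w C)%:E));
  rewrite fC nC eqxx.
Qed.

Lemma weight_swap A B S :
  weight w (swap A B S) + weight w (swap B A S) = weight w A + weight w B.
Proof.
have split_sum C : weight w C =
    \sum_(e in C | e.1 \in S) w e + \sum_(e in C | e.1 \notin S) w e.
  by rewrite /weight (bigID (fun e : T * T => e.1 \in S)).
have swE A' B' : weight w (swap A' B' S) =
    \sum_(e in B' | e.1 \in S) w e + \sum_(e in A' | e.1 \notin S) w e.
  by rewrite split_sum; congr (_ + _); apply: eq_bigl => -[x y];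
    rewrite in_swap /=; case: (x \in S); rewrite ?andbF ?andbT.
by rewrite !swE !split_sum; lra.
Qed.

Variable k : nat.
Hypothesis k_gt0 : (0 < k)%N.
Hypothesis gap : (phi E w k - phi E w k.+1 < phi E w k.-1 - phi E w k)%E.

Local Notation opt := (opt_forest E w k).

Lemma opt_forestP A :
  opt A -> [/\ is_forest E A, #|roots A| = k & phi E w k = (weight w A)%:E].
Proof.
move=> /and3P[fA /eqP nA /eqP wA]; split => //.
by case/is_forestP: fA => _ fA acA; rewrite -ntreesE.
Qed.

Lemma opt_functional A : opt A -> functional A.
Proof. by case/opt_forestP => /is_forestP[]. Qed.

Lemma opt_acyclic A : opt A -> acyclic A.
Proof. by case/opt_forestP => /is_forestP[]. Qed.

Lemma gap_weight A C C' : opt A ->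
  is_forest E C -> ntrees C = k.-1 -> is_forest E C' -> ntrees C' = k.+1 ->
  weight w A + weight w A < weight w C + weight w C'.
Proof.
case/opt_forestP => _ _ wA fC nC fC' nC'.
have := phi_le fC nC; have := phi_le fC' nC'; move: gap; rewrite wA.
(* The weights of [C] and [C'] exclude [+oo], the gap excludes [-oo]. *)
case: (phi E w k.+1) => [a| |]; case: (phi E w k.-1) => [b| |] //=.
by rewrite -!EFinB !lte_fin !lee_fin; lra.
Qed.

(** The two swaps have total weight twice the minimum and together [2k] trees. Unequal counts would
    give [k.-1] and [k.+1] trees, against the gap; with equal counts neither swap can be below the
    minimum, so both attain it. *)
Lemma opt_swap A B S : opt A -> opt B ->
  acyclic (swap A B S) -> acyclic (swap B A S) ->
  (#|roots A :&: S| <= #|roots B :&: S|.+1)%N ->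
  (#|roots B :&: S| <= #|roots A :&: S|.+1)%N ->
  #|roots A :&: S| = #|roots B :&: S| /\ opt (swap A B S).
Proof.
move=> oA oB acAB acBA leAB leBA.
have [fA rA wA] := opt_forestP oA; have [fB rB wB] := opt_forestP oB.
have fAB := swap_forest fA fB acAB; have fBA := swap_forest fB fA acBA.
have nAB : ntrees (swap A B S) = (#|roots A :\: S| + #|roots B :&: S|)%N.
  by case/is_forestP: fAB => _ f ac; rewrite ntreesE // card_roots_swap.
have nBA : ntrees (swap B A S) = (#|roots B :\: S| + #|roots A :&: S|)%N.
  by case/is_forestP: fBA => _ f ac; rewrite ntreesE // card_roots_swap.
move: rA rB; rewrite -(cardsID S (roots A)) -(cardsID S (roots B)) => rA rB.
have wAB : weight w A = weight w B by move: wA; rewrite wB => -[].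
have ws := weight_swap A B S.
have [eq_r|/eqP ne_r] := eqVneq #|roots A :&: S| #|roots B :&: S|.
  split=> //; apply/and3P; split=> //; first by apply/eqP; lia.
  have kAB : ntrees (swap A B S) = k by lia.
  have kBA : ntrees (swap B A S) = k by lia.
  have := phi_le fAB kAB; have := phi_le fBA kBA; rewrite wA eqe !lee_fin.
  move: ws; rewrite -wAB => ws leBA' leAB'; rewrite eq_le leAB' andbT.
  by rewrite -(lerD2r (weight w (swap B A S))) ws lerD2l.
have [lt|gt] : (#|roots A :&: S| < #|roots B :&: S|)%N \/
  (#|roots B :&: S| < #|roots A :&: S|)%N by lia.
- have k1 : ntrees (swap A B S) = k.+1 by lia.
  have k2 : ntrees (swap B A S) = k.-1 by lia.
  by have := gap_weight oA fBA k2 fAB k1; rewrite [ltRHS]addrC ws -wAB ltxx.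
- have k1 : ntrees (swap B A S) = k.+1 by lia.
  have k2 : ntrees (swap A B S) = k.-1 by lia.
  by have := gap_weight oA fAB k2 fBA k1; rewrite ws -wAB ltxx.
Qed.

Definition tree_of A x := [set z | root_of A z == root_of A x].

Lemma tree_of_closed A x y z : opt A -> (y, z) \in A ->
  (z \in tree_of A x) = (y \in tree_of A x).
Proof.
move=> oA yz; rewrite !inE.
by rewrite (root_of_arc (opt_functional oA) (opt_acyclic oA) yz).
Qed.

(** No arc of [A] joins a tree of [A] to its complement, so both of these sets are closed under
    [A]. *)
Lemma acyclic_swap_tree A B x : opt A -> opt B ->
  acyclic (swap A B (tree_of A x)) /\ acyclic (swap B A (tree_of A x)).
Proof.
move=> oA oB; have [acA acB] := (opt_acyclic oA, opt_acyclic oB).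
rewrite -(swap_setC B A); split; apply: swap_acyclic_closed => // y z yz.
  by rewrite !in_setC (tree_of_closed _ oA yz).
by rewrite (tree_of_closed _ oA yz).
Qed.

Lemma card_roots_tree A x : opt A -> #|roots A :&: tree_of A x| = 1%N.
Proof.
move=> oA; have [fA acA] := (opt_functional oA, opt_acyclic oA).
apply/eqP/cards1P; exists (root_of A x); apply/setP => z; rewrite !inE.
have [->|ne] := eqVneq z (root_of A x).
  by rewrite root_of_root // root_of_id ?eqxx // root_of_root.
apply/negbTE; apply: contra ne => /andP[rz /eqP <-].
by rewrite root_of_id.
Qed.

(** A tree without roots of [B] would give the counts 1 and 0, which [opt_swap] forces to be
    equal. *)
Lemma tree_meets_roots A B x : opt A -> opt B ->
  exists2 b, is_root B b & root_of A b = root_of A x.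
Proof.
move=> oA oB; have [ac1 ac2] := acyclic_swap_tree x oA oB.
have [h0|[b]] := set_0Vmem (roots B :&: tree_of A x); last first.
  by rewrite !inE => /andP[rb /eqP eb]; exists b.
have := opt_swap oA oB ac1 ac2; rewrite card_roots_tree // h0 cards0.
by move=> /(_ isT isT)[].
Qed.

(** By [tree_meets_roots] the map is onto the roots of [A], and both root sets have [k] elements. *)
Lemma root_of_inj A B : opt A -> opt B -> {in roots B &, injective (root_of A)}.
Proof.
move=> oA oB; have [fA acA] := (opt_functional oA, opt_acyclic oA).
have [[_ kA _] [_ kB _]] := (opt_forestP oA, opt_forestP oB).
apply/imset_injP/eqP; rewrite kB -kA.
congr #|pred_of_set _|; apply/setP => r; apply/imsetP/idP => [[b _ ->]|].
  by rewrite inE root_of_root.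
rewrite inE => rr; have [b rb eb] := tree_meets_roots r oA oB.
by exists b; rewrite ?inE // eb root_of_id.
Qed.

Lemma opt_swap_tree A B x : opt A -> opt B -> opt (swap A B (tree_of A x)).
Proof.
move=> oA oB; have [ac1 ac2] := acyclic_swap_tree x oA oB.
have rB : (#|roots B :&: tree_of A x| <= 1)%N.
  apply/card_le1_eqP => b c; rewrite !inE => /andP[rb /eqP eb] /andP[rc /eqP ec].
  by apply: (root_of_inj oA oB); rewrite ?inE // eb ec.
have [||//] := opt_swap oA oB ac1 ac2; rewrite card_roots_tree //.
exact: leq_trans rB _.
Qed.

(* Exchanging the [A]-tree of [x] moves its root to [x] and leaves the other
   roots alone; the tree of [H] containing [x] must lose a root in exchange. *)
Lemma root_of_equiv A G H x : opt A -> opt G -> opt H -> is_root G x ->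
  root_of H (root_of A x) = root_of H x.
Proof.
move=> oA oG oH rx; have [fA acA] := (opt_functional oA, opt_acyclic oA).
have [a ra ea] := tree_meets_roots x oH oA.
have [aD|aD] := boolP (a \in tree_of A x).
  by move: aD; rewrite inE root_of_id // => /eqP <-.
have oA' := opt_swap_tree x oA oG.
have ax : a = x.
  by apply: (root_of_inj oH oA'); rewrite ?inE // swap_root ?(negPf aD) // inE eqxx.
by move: aD; rewrite ax inE eqxx.
Qed.

(** * Atoms and the roots of their vertices *)

Lemma atom_same_root U A x y : is_atom (gens E w k) U -> opt A ->
  x \in U -> y \in U -> root_of A x = root_of A y.
Proof.
move=> atU oA xU yU; have [fA acA] := (opt_functional oA, opt_acyclic oA).
have gA : Defs.comp A x \in gens E w k.
  rewrite inE; apply/existsP; exists A; rewrite oA.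
  by apply/imsetP; exists x.
have xx : x \in Defs.comp A x by rewrite mem_comp.
have /subsetP/(_ y yU) := atom_sub atU gA xU xx.
by rewrite mem_comp // => /eqP.
Qed.

Lemma atom_separating_forest U x y : is_atom (gens E w k) U ->
  x \in U -> y \notin U -> exists2 A, opt A & root_of A x <> root_of A y.
Proof.
move=> atU xU yU; have [X] := atom_separate atU xU yU.
rewrite inE => /existsP[A /andP[oA /imsetP[z _ ->]]].
have [fA acA] := (opt_functional oA, opt_acyclic oA).
by rewrite !mem_comp // => ne; exists A => // exy; rewrite exy eqxx in ne.
Qed.

(** Were the root outside [M], some minimal forest would separate it from the vertex [x] of [M] that
    is a root of [G], against [root_of_equiv]. *)
Lemma labeled_atom_root M A m : is_atom (gens E w k) M -> labeled E w k M ->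
  opt A -> m \in M -> root_of A m \in M.
Proof.
move=> atM /existsP[G /existsP[x /and3P[oG rx xM]]] oA mM.
rewrite (atom_same_root atM oA mM xM); apply: contraT.
move=> /(atom_separating_forest atM xM)[H oH []].
by rewrite (root_of_equiv oA oG oH rx).
Qed.


(** * Two inseparable vertices cannot both exit a tree *)

Section TwoExits.
Variables (A B : {set T * T}) (x0 : T).
Hypotheses (oA : opt A) (oB : opt B).
Local Notation D := (tree_of A x0).
Hypothesis agree : forall x y, x \notin D -> ((x, y) \in B) = ((x, y) \in A).

Definition inseparable x y := forall C, opt C -> root_of C x = root_of C y.

Definition exits x := x \in D /\ exists2 y, (x, y) \in B & y \notin D.

Lemma outside_closedA x y : reach A x y -> x \notin D -> y \notin D.
Proof.
apply: (@reach_closed _ A [predC D]) => {}x {}y xy.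
by rewrite !inE (root_of_arc (opt_functional oA) (opt_acyclic oA) xy).
Qed.

Lemma outside_closedB x y : reach B x y -> x \notin D -> y \notin D.
Proof.
apply: (@reach_closed _ B [predC D]) => {}x {}y xy xD.
by apply: outside_closedA (xD); apply: connect1; rewrite -agree.
Qed.

(** Two vertices on one [B]-path are comparable, but a path that has left [D] through one exit never
    returns to reach the other. *)
Lemma exits_disjoint a b z :
  exits a -> exits b -> a <> b -> reach B z a -> reach B z b -> False.
Proof.
have ff := opt_functional oB.
have noreach c d : exits c -> exits d -> c <> d -> ~ reach B c d.
  move=> [_ [m cm mD]] [dD _] ne /reach_step[//|[m' cm']].
  by rewrite -(ff _ _ _ cm cm') => /outside_closedB/(_ mD); rewrite dD.
move=> ea eb ne za zb; case: (reach_comparable ff za zb).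
  exact: noreach.
by apply: noreach => // /esym.
Qed.

(* For [c] as below, exchange between [A] and [B] the vertices whose [B]-path
   leaves the tree through [b] and whose [A]-path visits [c]: this sends [b]
   outside [D], so the [A]-path of [a] must visit one of the vertices. *)
Lemma detour a b c : a \in D -> exits b -> inseparable a b ->
  c \in D -> reach A b c -> ~~ reach B c b || is_root A c ->
  exists2 y, reach B y b & reach A a y && reach A y c.
Proof.
move=> aD [bD [v bv vD]] same cD bc hc.
have [[fA acA] [fB acB]] := (opt_functional oA, opt_acyclic oA,
  (opt_functional oB, opt_acyclic oB)).
(* [S] is the set to exchange. [W] is closed under [A] and catches every [B]-arc that leaves [S]; in
   particular [(b, v)], as [v] cannot reach [c] in [D]. *)
pose S := [set y | reach B y b && reach A y c].
pose W := [set y | ~~ reach A y c].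
have PD y : reach B y b -> y \in D.
  by move=> yb; apply: contraLR bD; apply: outside_closedB.
have SW x : x \in W -> (x \in S) = false.
  by rewrite !inE => /negPf->; rewrite andbF.
have clW x y : (x, y) \in A -> x \in W -> y \in W.
  by move=> xy; rewrite !inE; apply: contra; apply: reach_arc.
have clSW x y : (x, y) \in B -> x \in S -> y \in S :|: W.
  move=> xy; rewrite !inE => /andP[xb _].
  have [yc|yc] := boolP (reach A y c); last by rewrite orbT.
  rewrite andbT orbF; case: (reach_step xb) => [exb|[z xz]]; last first.
    by rewrite (fB _ _ _ xy xz).
  rewrite exb in xy; rewrite (fB _ _ _ xy bv) in yc.
  by have := outside_closedA yc vD; rewrite cD.
have ac1 : acyclic (swap A B S).
  (* Two nested splits: [S :|: W] is closed in the swap, and [W] is closed within it. *)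
  pose C := [set e in swap A B S | e.1 \in S :|: W].
  have acC : acyclic C.
    apply: (@acyclic_split _ W A B) => // x y; rewrite inE in_swap /= => /andP[].
    - by move=> xy _ xW; apply: clW (xW); move: xy; rewrite SW.
    - by move=> xy _ xW _; move: xy; rewrite SW.
    - by move=> xy xSW xW _; move: xSW xy; rewrite in_setU (negPf xW) orbF => ->.
  apply: (@acyclic_split _ (S :|: W) C A) => // x y.
  - rewrite in_swap; case: ifP => [xS xy _|xS xy]; first exact: clSW xy xS.
    by rewrite in_setU xS /= => xW; rewrite in_setU (clW _ _ xy xW) orbT.
  - by move=> xy xX _; rewrite inE xy.
  - by rewrite in_swap in_setU negb_or => xy /andP[/negPf xS _] _; move: xy; rewrite xS.
have ac2 : acyclic (swap B A S).
  (* The complement of [P] is closed in this swap. Inside [P] the set [S] is closed: an [A]-arc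
     could lose [c] only by issuing from [c] itself, which [hc] forbids. *)
  pose P := [set y | reach B y b].
  have SP x : x \notin P -> (x \in S) = false by rewrite !inE => /negPf->.
  pose C := [set e in swap B A S | (e.1 \in P) && (e.2 \in P)].
  have acC : acyclic C.
    apply: (@acyclic_split _ S A B) => // x y; rewrite inE in_swap /= => /andP[].
    - move=> xy /andP[_ yP] xS; move: xy; rewrite xS => xy.
      move: yP xS; rewrite !inE => -> /andP[xb] /reach_step[exc|[z xz]].
        move: hc; rewrite -exc xb /= => /forallP/(_ y).
        by rewrite xy.
      by rewrite (fA _ _ _ xy xz).
    - by move=> xy _ xS _; move: xy; rewrite xS.
    - by move=> xy _ /negPf xS _; move: xy; rewrite xS.
  apply: (@acyclic_split _ (~: P) B C) => // x y; rewrite ?in_swap ?in_setC.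
  - move=> xy xP; move: xy; rewrite SP // => xy.
    by apply: contra xP; rewrite !inE; apply: reach_arc.
  - by move=> xy xP _; move: xy; rewrite SP.
  - by rewrite !negbK => xy xP yP; rewrite inE in_swap xy xP.
(* Every vertex of [S] leads to [b] in [B], and [b] is not a root of [B]. *)
have rB : roots B :&: S = set0.
  apply/setP => r; rewrite !inE; apply/negP => /and3P[rr rb _].
  by move/forallP/(_ v): (rr); rewrite -(reach_root rr rb) bv.
have rA : (#|roots A :&: S| <= 1)%N.
  rewrite -(card_roots_tree x0 oA); apply/subset_leq_card/setIS/subsetP => y.
  by rewrite inE => /andP[/PD].
have [|//|_ oC] := opt_swap oA oB ac1 ac2; first by rewrite rB cards0.
  by rewrite rB cards0.
(* If the [A]-path of [a] avoids [S], the swap keeps the root of [a] in [D] but sends [b] through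
   [v] to a root outside [D], against [same]. *)
apply/exists_inP; apply: contraT; rewrite negb_exists_in => /forall_inP avoid.
have fC := opt_functional oC.
have avS z : reach A a z -> z \notin S.
  by move=> az; rewrite inE; apply/negP => /andP[/avoid]; rewrite az => /negP.
have ra : root_of (swap A B S) a = root_of A a.
  have ar := reach_root_of acA a.
  apply: root_of_uniq => //; first exact: swap_reach.
  by rewrite swap_root (negPf (avS _ ar)) root_of_root.
have bS : b \in S by rewrite inE bc andbT; apply: connect0.
have : root_of (swap A B S) v \notin D.
  apply: (@reach_closed _ (swap A B S) [predC D]) (reach_root_of ac1 v) vD.
  move=> x y xy xD; apply: outside_closedA (xD); apply: connect1.
  move: xy; rewrite in_swap; case: ifP => // /[!inE] /andP[/PD].
  by rewrite (negPf xD).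
have bvC : (b, v) \in swap A B S by rewrite in_swap bS.
rewrite -(root_of_arc fC ac1 bvC) -(same _ oC) ra inE.
rewrite (root_of_id fA acA (root_of_root acA a)).
by move: aD; rewrite inE => ->.
Qed.

Lemma no_two_exits a b : exits a -> exits b -> inseparable a b -> a = b.
Proof.
move=> ea eb same; apply/eqP; apply: contraT => /eqP ne.
have [[fA acA] [fB acB]] := (opt_functional oA, opt_acyclic oA,
  (opt_functional oB, opt_acyclic oB)).
have aD : a \in D by case: ea.
have bD : b \in D by case: eb.
have inD x : x \in D -> root_of A x \in D.
  by rewrite !inE (root_of_id fA acA (root_of_root acA x)).
(* The first [c] is the root of [b] in [A]; later ones are admissible because they do not reach the
   other exit in [B]. *)
have [y yb /andP[ay _]] : exists2 y, reach B y b &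
    reach A a y && reach A y (root_of A b).
  by apply: detour => //; [apply: inD | apply: reach_root_of |
    rewrite root_of_root ?orbT].
(* Descent along [A]: [y] is preceded by such a vertex with [a], [b] exchanged. *)
have [n] := ubnP #|[set z | reach A z y]|.
elim: n a b y ea eb same ne aD bD ay yb => // n IHn a b y ea eb same ne aD bD ay yb.
have yD : y \in D by apply: contraLR bD; apply: outside_closedB.
have ya : ~~ reach B y a by apply/negP => ya; apply: exits_disjoint ya yb.
have same' : inseparable b a by move=> C oC; rewrite same.
have [|z za /andP[bz zy]] := detour bD ea same' yD ay; first by rewrite ya.
rewrite ltnS => le_n; apply: (IHn b a z) => //; first by move/esym.
apply: leq_trans le_n; apply/proper_card/properP; split.
  by apply/subsetP => t; rewrite !inE => tz; apply: connect_trans tz zy.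
(* The vertex lost is [y]: otherwise acyclicity gives [z = y], though only [z] leads to [a] in
   [B]. *)
exists y; rewrite inE; first exact: connect0.
apply/negP => yz; by move: za ya; rewrite (acyclic_anti acA zy yz) => ->.
Qed.

End TwoExits.

End Weighted.

(** * Uniqueness of the arc leaving the atom *)

Unset Implicit Arguments.

Theorem theorem2 (R : realDomainType) (T : finType) (E : {set T * T})
    (w : T * T -> R)
    (hspan : exists F : {set T * T}, is_forest E F /\ ntrees F = 1%N)
    (k : nat) (hk1 : (1 <= k)%N) (hkN : (k <= #|T| - 1)%N)
    (hgap : (phi E w k - phi E w k.+1 < phi E w k.-1 - phi E w k)%E)
    (F : {set T * T}) (hF : opt_forest E w k F)
    (U M : {set T})
    (hU : is_atom (gens E w k) U) (hUl : ~~ labeled E w k U)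
    (hM : is_atom (gens E w k) M) (hMl : labeled E w k M)
    (e : T * T) (heF : e \in F) (heU : leaves U e) (heM : e.2 \in M) :
  forall e' : T * T, e' \in F -> leaves U e' -> e' = e.
Proof.
case: e heF heU heM => u m um /andP[/= uU mU] mM [u' v] uv /andP[/= u'U vU].
suff eu : u' = u by rewrite eu in uv *; rewrite (opt_functional hF uv um).
have [G oG sep] := atom_separating_forest hU u'U vU.
have same C : opt_forest E w k C -> root_of C u' = root_of C u.
  by move=> oC; apply: atom_same_root hU oC u'U uU.
pose D := tree_of G u; pose B := swap G F D.
have oB : opt_forest E w k B by apply: opt_swap_tree.
have uD : u \in D by rewrite inE.
have u'D : u' \in D by rewrite inE same.
have vD : v \notin D by rewrite inE -same // eq_sym; apply/eqP.
have umB : (u, m) \in B by rewrite in_swap uD.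
have uvB : (u', v) \in B by rewrite in_swap u'D.
have agree x y : x \notin D -> ((x, y) \in B) = ((x, y) \in G).
  by move=> /negPf xD; rewrite in_swap xD.
(* If [m] is outside [D], both [u'] and [u] exit [D] in [B]. *)
have [mD|mD] := boolP (m \in D); last first.
  apply: (no_two_exits hk1 hgap oG oB agree) => //.
    by split=> //; exists v.
  by split=> //; exists m.
have [fB acB] := (opt_functional oB, opt_acyclic oB).
have [fF acF] := (opt_functional hF, opt_acyclic hF).
(* The root of [m] in [F] stays in [M], hence in [D], where [B] follows [F]. So it is a root of [B],
   and it is the [B]-root of [m] and of [u]; the [B]-path of [u'] instead stays outside [D] from [v]
   on. *)
have yM := labeled_atom_root hk1 hgap hM hMl hF mM.
have yD : root_of F m \in D.
  by move: mD; rewrite !inE (atom_same_root hM oG mM yM).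
have ry : is_root B (root_of F m) by rewrite swap_root yD root_of_root.
have eu : root_of B u = root_of F m.
  by rewrite (root_of_arc fB acB umB) (atom_same_root hM oB mM yM) root_of_id.
have := outside_closedB oG agree (reach_root_of acB v) vD.
by rewrite -(root_of_arc fB acB uvB) same // eu yD.
Qed.
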